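(* Let $k\in\mathbb{N}$, and let $n_i\in\mathbb{N}$ and $x_i\in[0,1]$ for $i=1,\ldots,k$. Let $m=\sum_{i=1}^k n_i$, and for $i=1,\ldots,k$ let $$\widetilde{n_i}=n_1+\cdots+n_i,\qquad \widetilde{x_i}=\frac{n_1x_1+\cdots+n_ix_i}{\widetilde{n_i}}.$$ For a convex function $f\in\mathcal{C}([0,1])$ and $j\in\{1,\ldots,k\}$ put $$L_j=\sum_{i_j=0}^{\widetilde{n_j}}\ \sum_{i_{j+1}=0}^{n_{j+1}}\cdots\sum_{i_k=0}^{n_k}p_{\widetilde{n_j},i_j}(\widetilde{x_j})\,p_{n_{j+1},i_{j+1}}(x_{j+1})\cdots p_{n_k,i_k}(x_k)\, f\left(\frac{i_j+i_{j+1}+\cdots+i_k}{m}\right),$$ $$R_j=\frac{\widetilde{n_j}}{m}\,(B_m f)(\widetilde{x_j})+\frac{n_{j+1}}{m}\,(B_m f)(x_{j+1})+\cdots+\frac{n_k}{m}\,(B_m f)(x_k),$$ so that in particular $$L_1=\sum_{i_1=0}^{n_1}\cdots\sum_{i_k=0}^{n_k}p_{n_1,i_1}(x_1)\cdots p_{n_k,i_k}(x_k)\, f\left(\frac{i_1+\cdots+i_k}{m}\right),\quad R_1=\sum_{i=1}^k\frac{n_i}{m}(B_mf)(x_i),\quad L_k=R_k=(B_mf)\left(\sum_{i=1}^k\frac{n_i}{m}x_i\right).$$ Then for all convex functions $f\in\mathcal{C}([0,1])$ and all $j=3,\ldots,k-1$, $$L_1\leq L_{j-1}\leq L_j\leq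 L_{j+1}\leq\cdots\leq L_k=(B_{m}f)\left(\sum_{i=1}^k\frac{n_i}{m}\, x_i\right)$$ and $$(B_{m}f)\left(\sum_{i=1}^k\frac{n_i}{m}\, x_i\right)=R_k\leq R_{k-1}\leq\cdots\leq R_j\leq R_{j-1}\leq\cdots\leq R_1=\sum_{i=1}^k\frac{n_i}{m}\,(B_m f)(x_i).$$
   Context: $\mathbb{N}$ denotes the positive integers, and $\mathcal{C}([0,1])$ the continuous real-valued functions on $[0,1]$. For $n\in\mathbb{N}$, the Bernstein basic polynomials are $p_{n,i}(x)=\binom{n}{i}x^i(1-x)^{n-i}$ for $i=0,1,\dots,n$, $x\in[0,1]$ (with $0^0=1$). The Bernstein operator $B_n:\mathcal{C}([0,1])\to\mathcal{C}([0,1])$ is $(B_nf)(x)=\sum_{i=0}^n p_{n,i}(x)f\left(\frac in\right)$ for $x\in[0,1]$. *)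

(* Defs.v *)
From HB Require Import structures.
From mathcomp Require Import all_boot all_order all_algebra.
From mathcomp Require Import all_classical all_reals all_analysis.

Set Implicit Arguments.
Unset Strict Implicit.
Unset Printing Implicit Defensive.

Import Order.TTheory GRing.Theory Num.Theory.
Import numFieldNormedType.Exports.

Local Open Scope classical_set_scope.
Local Open Scope ring_scope.

(* Functions on [0, 1] are represented by functions on R; only their values on
   [0, 1] matter. *)
Section Bernstein.
Context {R : realType}.
Implicit Types (f : R -> R) (n : nat -> nat) (x : nat -> R).

Definition bernp (d i : nat) (y : R) : R :=
  'C(d, i)%:R * y ^+ i * (1 - y) ^+ (d - i).

Definition bernstein (d : nat) f (y : R) : R :=
  \sum_(i < d.+1) bernp d i y * f (i%:R / d%:R).

(* The iterated sum, over a list s = [:: (d_1, y_1); ...; (d_r, y_r)],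
     \sum_(i_1 < d_1.+1) ... \sum_(i_r < d_r.+1)
       w * bernp d_1 i_1 y_1 * ... * bernp d_r i_r y_r
         * f ((t + i_1 + ... + i_r) / m);
   w and t accumulate the product of the weights and the sum of the indices,
   and are initially 1 and 0. *)
Fixpoint nested_sum_rec f (m : nat) (s : seq (nat * R)) (w : R) (t : nat) : R :=
  match s with
  | [::] => w * f (t%:R / m%:R)
  | (d, y) :: s' =>
      \sum_(i < d.+1) nested_sum_rec f m s' (w * bernp d i y) (t + i)%N
  end.

Definition nested_sum f (m : nat) (s : seq (nat * R)) : R :=
  nested_sum_rec f m s 1 0.

(* Families n_1, ..., n_k and x_1, ..., x_k are indexed from 1: the values at 0
   and beyond k are never used. *)
Definition partial_total n (j : nat) : nat := (\sum_(1 <= i < j.+1) n i)%N.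

Definition partial_mean n x (j : nat) : R :=
  (\sum_(1 <= i < j.+1) (n i)%:R * x i) / (partial_total n j)%:R.

Definition Lsum f (k : nat) n x (j : nat) : R :=
  nested_sum f (partial_total n k)
    ((partial_total n j, partial_mean n x j) ::
       [seq (n i, x i) | i <- index_iota j.+1 k.+1]).

Definition Rsum f (k : nat) n x (j : nat) : R :=
  let m := partial_total n k in
  (partial_total n j)%:R / m%:R * bernstein m f (partial_mean n x j)
  + \sum_(j.+1 <= i < k.+1) (n i)%:R / m%:R * bernstein m f (x i).

End Bernstein.

(* Main.v *)
(* Every quantity is the expectation of [f (S / m)], where [S] counts the
   successes in [m] independent trials, so everything reduces to the
   multi-affine symmetric function [bern_exp] of the success probabilities,
   whose mixed second derivatives are expectations of second differences of
   [f (i / m)], hence nonnegative.  Passing from [L_j] to [L_(j+1)] replaces a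
   block of probabilities by their mean, which increases the expectation
   (Hoeffding).  The inequalities between the [R_j] are instances of the
   convexity of [B_m f], the restriction of this function to the diagonal;
   convexity comes from an affine minorant at each point, obtained by changing
   one probability at a time. *)
Require Import Defs.
From HB Require Import structures.
From mathcomp Require Import all_boot all_order all_algebra.
From mathcomp Require Import all_classical all_reals all_analysis.
From mathcomp Require Import ring lra.

Import Order.TTheory GRing.Theory Num.Theory.
Import numFieldNormedType.Exports.

Local Open Scope classical_set_scope.
Local Open Scope ring_scope.

(** * Expectations over independent Bernoulli trials *)

Section BernoulliExpectation.
Context {R : comPzRingType}.
Implicit Types (s r : seq R) (g h : nat -> R) (p q : R).

(* The expectation of [g S], where [S] is the number of successes in
   independent trials with success probabilities [s]. *)
Fixpoint bern_exp s g : R :=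
  if s is p :: s' then
    (1 - p) * bern_exp s' g + p * bern_exp s' (fun i => g i.+1)
  else g 0.

Definition fdiff g (i : nat) : R := g i.+1 - g i.

Lemma eq_bern_exp s g h : g =1 h -> bern_exp s g = bern_exp s h.
Proof.
elim: s g h => [|p s IH] g h gh /=; first exact: gh.
by congr (_ * _ + _ * _); apply: IH => // i.
Qed.

Lemma bern_expD s g h :
  bern_exp s (fun i => g i + h i) = bern_exp s g + bern_exp s h.
Proof. by elim: s g h => [|p s IH] g h //=; rewrite !IH; ring. Qed.

Lemma bern_expZ s a g : bern_exp s (fun i => a * g i) = a * bern_exp s g.
Proof. by elim: s g => [|p s IH] g //=; rewrite !IH; ring. Qed.

Lemma bern_expB s g h :
  bern_exp s (fun i => g i - h i) = bern_exp s g - bern_exp s h.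
Proof. by elim: s g h => [|p s IH] g h //=; rewrite !IH; ring. Qed.

(** By the recursion, [bern_exp (p :: s) g] is affine in [p]; this is its slope. *)
Lemma bern_exp_fdiff s g :
  bern_exp s (fdiff g) = bern_exp s (fun i => g i.+1) - bern_exp s g.
Proof. exact: bern_expB. Qed.

Lemma bern_exp_cat s r g :
  bern_exp (s ++ r) g = bern_exp s (fun i => bern_exp r (fun j => g (i + j)%N)).
Proof. by elim: s g => [|p s IH] g //=; rewrite !IH. Qed.

Lemma bern_exp_exchange s r (h : nat -> nat -> R) :
  bern_exp s (fun i => bern_exp r (h i)) =
  bern_exp r (fun j => bern_exp s (h^~ j)).
Proof.
elim: s h => [|p s IH] h //=.
by rewrite bern_expD !bern_expZ IH (IH (fun i => h i.+1)).
Qed.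

(** Swaps of adjacent blocks generate all permutations, and such a swap is an exchange of two
    independent averages. *)
Lemma perm_bern_exp s r g : perm_eq s r -> bern_exp s g = bern_exp r g.
Proof.
apply: (catCA_perm_subst (F := bern_exp^~ g)) => s1 s2 s3.
rewrite !bern_exp_cat; under eq_bern_exp do rewrite bern_exp_cat.
rewrite bern_exp_exchange; apply: eq_bern_exp => j.
rewrite bern_exp_cat; apply: eq_bern_exp => i; apply: eq_bern_exp => l.
by rewrite addnCA.
Qed.

End BernoulliExpectation.

(** * Smoothing and convexity for discretely convex functions *)

Section DiscreteConvexity.
Context {R : realDomainType}.
Implicit Types (s r : seq R) (g : nat -> R) (p q c u v : R).

(** The range is bounded because [f (i / m)] is controlled only for [i <= m]. *)
Definition discrete_convex (N : nat) g :=
  forall i, (i.+2 <= N)%N -> 0 <= fdiff (fdiff g) i.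

Definition prob p : bool := (0 <= p <= 1).

Lemma bern_exp_ge0 s g : all prob s ->
  (forall i, (i <= size s)%N -> 0 <= g i) -> 0 <= bern_exp s g.
Proof.
elim: s g => [|p s IH] g /=; first by move=> _; apply.
move=> /andP[/andP[p0 p1] sP] g0; rewrite addr_ge0 ?mulr_ge0 ?subr_ge0 ?IH //.
all: by move=> i i_le; apply: g0; rewrite // leqW.
Qed.

Lemma bern_exp_fdiff2_ge0 s g N : all prob s -> discrete_convex N g ->
  ((size s).+2 <= N)%N -> 0 <= bern_exp s (fdiff (fdiff g)).
Proof.
by move=> sP gC sN; apply: bern_exp_ge0 => // i si; apply/gC/(leq_trans _ sN).
Qed.

Lemma discrete_convexW N M g : (M <= N)%N ->
  discrete_convex N g -> discrete_convex M g.
Proof. by move=> MN gC i iM; apply/gC/(leq_trans iM). Qed.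

Lemma discrete_convex_shift N g :
  discrete_convex N.+1 g -> discrete_convex N (fun i => g i.+1).
Proof. by move=> gC i iN; apply: (gC i.+1). Qed.

Lemma discrete_convex_bern_exp N g s : all prob s ->
  discrete_convex (N + size s) g ->
  discrete_convex N (fun i => bern_exp s (fun j => g (i + j)%N)).
Proof.
move=> sP gC i iN; rewrite /fdiff -!bern_expB.
apply: bern_exp_ge0 => // j js; rewrite !addSn; apply: gC.
by rewrite -2!addSn leq_add.
Qed.

(** The sum of the two parameters is preserved and their product grows by [(c - p) * (q - c)], so
    the two sides differ by this number times an expected second difference. *)
Lemma bern_exp_cons2_le c p q s g :
  all prob s -> discrete_convex (size s).+2 g -> 0 <= (c - p) * (q - c) ->
  bern_exp [:: p, q & s] g <= bern_exp [:: c, p + q - c & s] g.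
Proof.
move=> sP gC cpq; have D0 := bern_exp_fdiff2_ge0 _ _ _ sP gC (leqnn _).
rewrite -subr_ge0; have := mulr_ge0 cpq D0.
by congr (0 <= _); rewrite /fdiff !bern_expB /=; ring.
Qed.

(* Smoothing: two parameters [p], [q] lying on both sides of the mean [c] are
   replaced by [c] and [p + q - c], so one more parameter equals [c]. *)
Lemma bern_exp_le_mean s c g : all prob s -> prob c ->
  discrete_convex (size s) g -> \sum_(p <- s) p = (size s)%:R * c ->
  bern_exp s g <= bern_exp (nseq (size s) c) g.
Proof.
move: {2}(size s) (erefl (size s)) => d.
elim: d s g => [|d IH] [|p s] g //= [sz] /andP[pP sP] cP gC.
rewrite big_cons => sumE; rewrite sz.
(* Once the head is [c], the rest still has mean [c], and induction applies to both branches of the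
   head trial. *)
have step r : size r = d -> all prob r -> \sum_(p <- r) p = (size r)%:R * c ->
  bern_exp (c :: r) g <= bern_exp (c :: nseq d c) g.
  move=> rd rP rsum /=; move/andP: (cP) => [c0 c1].
  rewrite sz in gC.
  rewrite lerD // ler_wpM2l ?subr_ge0 // -rd IH // rd.
    exact: discrete_convexW gC.
  exact: discrete_convex_shift.
have [pc|pc] := eqVneq p c.
  by rewrite pc in sumE *; apply: step => //; move: sumE; rewrite -natr1; lra.
(* If every product were negative, their sum, which is [(c - p) ^+ 2], would be nonpositive, forcing
   [p = c]. *)
have [q qs cpq] : exists2 q, q \in s & 0 <= (c - p) * (q - c).
  apply/hasP; apply: contraT => /hasPn sneg.
  have : \sum_(q <- s) (c - p) * (q - c) <= 0.
    rewrite big_seq sumr_le0 // => q /sneg; rewrite -ltNge; exact: ltW.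
  rewrite -mulr_sumr big_split /= sumrN big_const_seq count_predT iter_addr_0.
  have -> : \sum_(q <- s) q - c *+ size s = c - p.
    by move: sumE; rewrite -natr1 -mulr_natl; lra.
  rewrite -expr2 le_eqVlt ltNge sqr_ge0 orbF sqrf_eq0 subr_eq0 eq_sym.
  by rewrite (negPf pc).
have sr := perm_to_rem qs; set r := rem q s in sr.
have rsz : (size r).+1 = d by rewrite -sz (perm_size sr).
have /andP[qP rP] : all prob (q :: r) by rewrite -(perm_all _ sr).
rewrite -[leLHS]/(bern_exp (p :: s) g).
rewrite (@perm_bern_exp _ (p :: s) [:: p, q & r]); last by rewrite perm_cons.
apply: (le_trans (bern_exp_cons2_le c _ _ _ _ rP _ cpq)).
  by rewrite rsz -sz.
apply: step => //.
  apply/andP; split=> //.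
  move/andP: pP => []; move/andP: qP => []; move/andP: cP => [].
  (* Since [c] lies between [p] and [q], so does [p + q - c]. *)
  case: (ltgtP p c) pc => // pc _ *; rewrite /prob.
    by move: cpq; rewrite pmulr_rge0 ?subr_gt0 // subr_ge0 => *; lra.
  by move: cpq; rewrite nmulr_rge0 ?subr_lt0 // subr_le0 => *; lra.
rewrite big_cons; move: sumE.
by rewrite (perm_big _ sr) big_cons /= (perm_size sr) /= -natr1; lra.
Qed.

(** The left side is the tangent at [u] to the expectation as a function of the value shared by [a]
    parameters. These are changed to [v] one at a time; [s] is arbitrary so that it can absorb those
    already changed. *)
Lemma bern_exp_nseq_tangent a s u v g :
  all prob s -> prob u -> prob v -> discrete_convex (a + size s) g ->
  bern_exp (nseq a u ++ s) g
    + a%:R * (v - u) * bern_exp (nseq a.-1 u ++ s) (fdiff g)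
  <= bern_exp (nseq a v ++ s) g.
Proof.
move=> + uP vP; elim: a s g => [|a IH] s g sP gC.
  by rewrite mul0r mul0r addr0.
have catE b w h :
    bern_exp (nseq b u ++ w :: s) h = bern_exp (w :: nseq b u ++ s) h.
  by apply: perm_bern_exp; rewrite -cat1s perm_catCA.
have -> : bern_exp (nseq a.+1 v ++ s) g = bern_exp (nseq a v ++ v :: s) g.
  by apply: perm_bern_exp; rewrite perm_sym -(cat1s v s) perm_catCA.
have := IH (v :: s) g; rewrite /= sP vP addnS => /(_ isT gC).
rewrite !catE; apply: le_trans; clear IH; case: a catE gC => [|a] catE gC.
  by rewrite /= !bern_exp_fdiff mul0r; lra.
(* The induction hypothesis exceeds the wanted tangent by [a.+1%:R * (v - u) ^+ 2] times this
   expectation. *)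
have D0 : 0 <= bern_exp (nseq a u ++ s) (fdiff (fdiff g)).
  apply: bern_exp_fdiff2_ge0 gC _; last by rewrite size_cat size_nseq.
  by rewrite all_cat sP all_nseq uP orbT.
rewrite -subr_ge0.
have := mulr_ge0 (ler0n R a.+1) (mulr_ge0 (sqr_ge0 (v - u)) D0).
by congr (0 <= _); rewrite /fdiff !bern_expB /= -[a.+2%:R]natr1; ring.
Qed.

(** In the weighted sum of the tangent bounds at [u], the slope terms cancel because
    [a * (y1 - u) + b * (y2 - u) = 0]. *)
Lemma bern_exp_nseq_convex d g y1 y2 a b :
  prob y1 -> prob y2 -> 0 <= a -> 0 <= b -> a + b = 1 -> discrete_convex d g ->
  bern_exp (nseq d (a * y1 + b * y2)) g
  <= a * bern_exp (nseq d y1) g + b * bern_exp (nseq d y2) g.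
Proof.
move=> y1P y2P a0 b0 ab gC; set u := _ + _.
have uP : prob u.
  move: y1P y2P => /andP[? ?] /andP[? ?]; rewrite /prob /u.
  by have -> : b = 1 - a by [lra]; apply/andP; split; nra.
have tan v (vP : prob v) := @bern_exp_nseq_tangent d [::] u v g isT uP vP.
rewrite /= addn0 in tan.
have := lerD (ler_wpM2l a0 (tan _ y1P gC)) (ler_wpM2l b0 (tan _ y2P gC)).
rewrite !cats0; apply: le_trans; rewrite le_eqVlt; apply/orP; left; apply/eqP.
by have -> : b = 1 - a by [lra]; rewrite /u; have -> : b = 1 - a by [lra]; ring.
Qed.

End DiscreteConvexity.

(** * Bernstein sums as Bernoulli expectations *)

Section Bernstein.
Context {R : realType}.
Implicit Types (f g : nat -> R) (s : seq (nat * R)).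

(** Conditioning on the first trial matches Pascal's rule for the binomial weights. *)
Lemma bern_exp_nseq d (y : R) g :
  bern_exp (nseq d y) g = \sum_(i < d.+1) bernp d i y * g i.
Proof.
elim: d g => [|d IH] g /=.
  by rewrite big_ord_recl big_ord0 /bernp bin0 !expr0; ring.
rewrite !IH [RHS]big_ord_recl.
rewrite (_ : bernp d.+1 0 y = (1 - y) * bernp d 0 y); last first.
  by rewrite /bernp !bin0 !subn0 exprS; ring.
have bernpS i : (i <= d)%N ->
    bernp d.+1 i.+1 y = (1 - y) * bernp d i.+1 y + y * bernp d i y.
  move=> id; rewrite /bernp binS natrD subSS exprS.
  (* At [i = d] the exponent [d - i.+1] truncates to 0, but ['C(d, d.+1)] vanishes. *)
  have [->|di] := eqVneq i d.
    by rewrite bin_small // subnn; ring.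
  by rewrite -(subnSK (m := i)) ?exprS; [ring | rewrite ltn_neqAle di].
under [in RHS]eq_bigr => i _ do
  rewrite (bernpS _ (ltn_ord i)) mulrDl -(mulrA (1 - y)) -(mulrA y).
rewrite big_split /= -!mulr_sumr addrA -mulrA -mulrDr; congr (_ * _ + _).
rewrite big_ord_recl; congr +%R.
rewrite [RHS]big_ord_recr /=.
by rewrite [bernp d d.+1 y]/bernp bin_small // !mul0r addr0.
Qed.

Lemma bernsteinE d (f : R -> R) y :
  bernstein d f y = bern_exp (nseq d y) (fun i => f (i%:R / d%:R)).
Proof. by rewrite bern_exp_nseq. Qed.

Definition trials s : seq R := flatten [seq nseq t.1 t.2 | t <- s].

Lemma nested_sum_recE (f : R -> R) m s w t :
  nested_sum_rec f m s w t =
  w * bern_exp (trials s) (fun i => f ((t + i)%:R / m%:R)).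
Proof.
elim: s w t => [|[d y] s IH] w t /=; first by rewrite addn0.
rewrite bern_exp_cat bern_exp_nseq mulr_sumr; apply: eq_bigr => i _.
rewrite IH mulrA; congr (_ * _); apply: eq_bern_exp => j.
by rewrite addnA.
Qed.

Lemma nested_sumE (f : R -> R) m s :
  nested_sum f m s = bern_exp (trials s) (fun i => f (i%:R / m%:R)).
Proof. by rewrite /nested_sum nested_sum_recE mul1r. Qed.

(** This is midpoint convexity: [i.+1 / m] is halfway between [i / m] and [i.+2 / m]. *)
Lemma discrete_convex_grid m (f : R -> R) : (0 < m)%N ->
  convex_function (`[0, 1] : set R) f ->
  discrete_convex m (fun i => f (i%:R / m%:R)).
Proof.
move=> m0 fC i im.
have mR : 0 < m%:R :> R by rewrite ltr0n.
have grid j : (j <= m)%N -> j%:R / m%:R \in (`[0, 1]%classic : set R).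
  move=> jm; rewrite inE /= in_itv /= divr_ge0 //= ler_pdivrMr // mul1r.
  by rewrite ler_nat.
have h0 : 0 <= 2^-1 :> R by lra.
have h1 : 2^-1 <= 1 :> R by lra.
have := fC (Itv01 h0 h1) _ _ (grid i (ltnW (ltnW im))) (grid i.+2 im).
rewrite -[leLHS]/(f (2^-1 * (i%:R / m%:R) + (1 - 2^-1) * (i.+2%:R / m%:R))).
rewrite -[leRHS]/(2^-1 * f (i%:R / m%:R) + (1 - 2^-1) * f (i.+2%:R / m%:R)).
have -> : 2^-1 * (i%:R / m%:R) + (1 - 2^-1) * (i.+2%:R / m%:R)
          = i.+1%:R / m%:R :> R.
  by rewrite -[i.+2%:R]natr1 -natr1; field; rewrite gt_eqF.
by rewrite /fdiff; lra.
Qed.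

End Bernstein.

(** * The two chains of inequalities *)

Theorem theorem2p11 (R : realType) (k : nat) (n : nat -> nat) (x : nat -> R)
    (m : nat) (f : R -> R)
    (k_gt0 : (0 < k)%N)
    (n_gt0 : forall i : nat, (1 <= i <= k)%N -> (0 < n i)%N)
    (x01 : forall i : nat, (1 <= i <= k)%N -> 0 <= x i <= 1)
    (mE : m = (\sum_(1 <= i < k.+1) n i)%N)
    (f_cont : {within `[0, 1], continuous f})
    (f_convex : convex_function (`[0, 1] : set R) f) :
  let L := Lsum f k n x in
  let R_ := Rsum f k n x in
  let xbar := \sum_(1 <= i < k.+1) (n i)%:R / m%:R * x i in
  [/\ L 1%N = nested_sum f m [seq (n i, x i) | i <- index_iota 1 k.+1],
      forall i j : nat, (1 <= i)%N -> (i <= j)%N -> (j <= k)%N -> L i <= L j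
    & L k = bernstein m f xbar] /\
  [/\ R_ k = bernstein m f xbar,
      forall i j : nat, (1 <= i)%N -> (i <= j)%N -> (j <= k)%N -> R_ j <= R_ i
    & R_ 1%N = \sum_(1 <= i < k.+1) (n i)%:R / m%:R * bernstein m f (x i)].
Proof.
move=> L R_ xbar.
have totk : partial_total n k = m by rewrite mE.
have totS j : partial_total n j.+1 = (partial_total n j + n j.+1)%N.
  by rewrite /partial_total big_nat_recr.
have tot_gt0 j : (1 <= j <= k)%N -> (0 < partial_total n j)%N.
  case: j => // j jk; rewrite totS addn_gt0 n_gt0 ?orbT //.
have totR_neq0 j : (1 <= j <= k)%N -> (partial_total n j)%:R != 0 :> R.
  by move=> /tot_gt0; rewrite pnatr_eq0 lt0n.
have m_gt0 : (0 < m)%N by rewrite -totk tot_gt0 // k_gt0 leqnn.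
have mR_gt0 : 0 < m%:R :> R by rewrite ltr0n.
have meanE j : (1 <= j <= k)%N ->
    (partial_total n j)%:R * partial_mean n x j
    = \sum_(1 <= i < j.+1) (n i)%:R * x i.
  by move=> jk; rewrite mulrC divfK ?totR_neq0.
have meanS j : (1 <= j)%N -> (j.+1 <= k)%N ->
    (partial_total n j.+1)%:R * partial_mean n x j.+1
    = (partial_total n j)%:R * partial_mean n x j + (n j.+1)%:R * x j.+1.
  by move=> j1 jk; rewrite !meanE ?j1 ?(ltnW jk) // big_nat_recr.
have meanP j : (1 <= j <= k)%N -> prob (partial_mean n x j).
  move=> jk; have t0 : 0 < (partial_total n j)%:R :> R by rewrite ltr0n tot_gt0.
  have xj i : (1 <= i < j.+1)%N -> 0 <= x i <= 1.
    move=> /andP[i1 ij]; apply: x01; rewrite i1 /=.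
    by case/andP: jk => _; apply: leq_trans; rewrite -ltnS.
  rewrite /prob divr_ge0 ?ler0n //=; last first.
    rewrite big_nat sumr_ge0 // => i /xj /andP[? _].
    by rewrite mulr_ge0 // ler0n.
  rewrite ler_pdivrMr // mul1r /partial_total natr_sum.
  rewrite !big_nat ler_sum // => i /xj /andP[_ ?].
  by rewrite ler_piMr // ler0n.
have mean1 : partial_mean n x 1 = x 1%N.
  rewrite /partial_mean /partial_total !big_nat1 mulrC mulKf //.
  by rewrite pnatr_eq0 -lt0n n_gt0.
have tot1 : partial_total n 1 = n 1%N by rewrite /partial_total big_nat1.
have meank : partial_mean n x k = xbar.
  rewrite /partial_mean totk mulr_suml; apply: eq_bigr => i _.
  by rewrite mulrAC.
have gC := discrete_convex_grid m f m_gt0 f_convex.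
set g := fun i : nat => f (i%:R / m%:R) in gC.
have mono (h : nat -> R) :
    (forall j, (1 <= j)%N -> (j.+1 <= k)%N -> h j <= h j.+1) ->
    forall i j, (1 <= i)%N -> (i <= j)%N -> (j <= k)%N -> h i <= h j.
  move=> hS i; elim=> [|j IH] i1; first by rewrite leqn0 => /eqP ->.
  rewrite leq_eqVlt => /orP[/eqP ->//|ij] jk.
  rewrite ltnS in ij.
  exact: le_trans (IH i1 ij (ltnW jk)) (hS _ (leq_trans i1 ij) jk).
pose tail j := trials [seq (n i, x i) | i <- index_iota j k.+1].
have tailS j : (j <= k)%N -> tail j = nseq (n j) (x j) ++ tail j.+1.
  by move=> jk; rewrite /tail /index_iota subSn //= -subSS.
have tailP j : (1 <= j)%N -> all prob (tail j).
  move=> j1; apply/allP => p /flattenP[_ /mapP[_ /mapP[i + ->] ->]].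
  rewrite mem_index_iota ltnS => /andP[ji ik] /nseqP[-> _].
  by apply: x01; rewrite ik (leq_trans j1).
have LE j : L j =
    bern_exp (nseq (partial_total n j) (partial_mean n x j) ++ tail j.+1) g.
  by rewrite /L /Lsum nested_sumE totk.
have size_tail j : (1 <= j <= k)%N ->
    (partial_total n j + size (tail j.+1))%N = m.
  move=> /andP[_ jk]; rewrite size_flatten /shape -!map_comp sumnE big_map.
  under eq_bigr do rewrite /= size_nseq.
  by rewrite mE /partial_total [RHS](@big_cat_nat _ _ _ j.+1) //= ltnW.
split; split.
- by rewrite LE tot1 mean1 -tailS // nested_sumE.
- apply: mono => j j1 jk.
  (* Averaging over the common trials [tail j.+2] first leaves two blocks with joint mean
     [partial_mean n x j.+1], to be smoothed. *)
  rewrite !LE tailS // catA bern_exp_cat [leRHS]bern_exp_cat.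
  have sE : size (nseq (partial_total n j) (partial_mean n x j)
                    ++ nseq (n j.+1) (x j.+1)) = partial_total n j.+1.
    by rewrite size_cat !size_nseq totS.
  rewrite -[X in nseq X (partial_mean _ _ j.+1)]sE; apply: bern_exp_le_mean.
  + rewrite all_cat !all_nseq meanP ?j1 ?(ltnW jk) // /prob x01 //.
    by rewrite !orbT.
  + by apply: meanP; rewrite jk.
  (* Averaging over the tail keeps discrete convexity in the number of earlier successes. *)
  + by rewrite sE; apply: discrete_convex_bern_exp;
       rewrite ?tailP ?size_tail ?jk.
  rewrite sE meanS // big_cat /= !big_nseq !iter_addr_0 /=.
  by rewrite !mulr_natl.
- rewrite LE /tail /index_iota subnn /trials /= cats0 totk meank.
  by rewrite bernsteinE.
- by rewrite /R_ /Rsum totk meank divff ?gt_eqF // mul1r big_geq // addr0.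
- move=> i j i1 ij jk; rewrite -lerN2; apply: (mono (fun j => - R_ j)) => //.
  move=> {i1 ij jk}{}j j1 jk; rewrite lerN2 /R_ /Rsum totk.
  (* The terms beyond [j.+1] cancel, leaving convexity at two points with weights [a] and [b]. *)
  rewrite [X in _ <= _ + X]big_ltn // addrA lerD2r.
  have jk' : (1 <= j <= k)%N by rewrite j1 ltnW.
  have jSk : (1 <= j.+1 <= k)%N by rewrite jk.
  have tS0 : 0 < (partial_total n j.+1)%:R :> R by rewrite ltr0n tot_gt0.
  set a := (partial_total n j)%:R / (partial_total n j.+1)%:R : R.
  set b := (n j.+1)%:R / (partial_total n j.+1)%:R : R.
  have ab : a + b = 1 by rewrite -mulrDl -natrD -totS divff ?gt_eqF.
  have meanSE : partial_mean n x j.+1 = a * partial_mean n x j + b * x j.+1.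
    apply: (mulfI (totR_neq0 _ jSk)); rewrite meanS // /a /b.
    by field; rewrite gt_eqF.
  have a0 : 0 <= a by rewrite divr_ge0 // ler0n.
  have b0 : 0 <= b by rewrite divr_ge0 // ler0n.
  have := bern_exp_nseq_convex m g _ _ _ _
            (meanP _ jk') (x01 _ jSk) a0 b0 ab gC.
  (* The factor [partial_total n j.+1 / m] turns [a] and [b] into the weights of [Rsum]. *)
  rewrite -meanSE -!bernsteinE => /(ler_wpM2l (ltW (divr_gt0 tS0 mR_gt0))).
  move=> /le_trans; apply; rewrite le_eqVlt; apply/orP; left; apply/eqP.
  by rewrite /a /b; field; rewrite !gt_eqF.
- by rewrite /R_ /Rsum totk tot1 mean1 [RHS]big_ltn.
Qed.
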